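(* Let $P=\{p_1,\ldots,p_m\}$ be a finite poset numbered so that $p_i<p_j$ implies $i<j$, let $A_1,\ldots,A_m$ be non-empty subsets of $[n]$, and let $\mathfrak{A}$ be a poset ideal of $\mathrm{Hom}(P,A_1,\ldots,A_m)$. Then $\mathcal{L}(\mathfrak{A})$ is weakly polymatroidal.
   Context: $n$ is a positive integer, $[n]=\{1,\ldots,n\}$, $\mathbf{K}$ is a field, $R=\mathbf{K}[X_{p,i}\mid p\in P,\ i\in[n]]$. $\mathrm{Hom}(P,A_1,\ldots,A_m)$ is the set of maps $f:P\to[n]$ that are isotone ($p\le q$ implies $f(p)\le f(q)$) with $f(p_i)\in A_i$ for all $i$, partially ordered by $f\le g$ iff $f(p)\le g(p)$ for all $p$. A poset ideal of a poset $Q$ is a non-empty subset $I\subseteq Q$ such that $y\in I$, $x\in Q$, $x\le y$ imply $x\in I$. For $f$ isotone, $U_f:=\prod_{p\in P}X_{p,f(p)}$, and $\mathcal{L}(\mathfrak{A}):=(U_f\mid f\in\mathfrak{A})\subseteq R$. For a monomial ideal $I$, $G(I)$ is its set of minimal monomial generators. A monomial ideal $I$ of $\mathbf{K}[X_1,\ldots,X_t]$ generated in a single degree is weakly polymatroidal if for every pair $u=X_1^{a_1}\cdots X_t^{a_t}$, $v=X_1^{b_1}\cdots X_t^{b_t}$ in $G(I)$ with $a_1=b_1,\ldots,a_{q-1}=b_{q-1}$ and $a_q<b_q$, there exists $q<p\le t$ such that $(X_qu)/X_p\in G(I)$. For $R$, the variables are ordered (first variable largest) as $$X_{p_1,1}>X_{p_1,2}>\cdots>X_{p_1,n}>X_{p_2,1}>\cdots>X_{p_2,n}>\cdots>X_{p_m,1}>\cdots>X_{p_m,n},$$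 i.e. $X_{p_1,1}$ plays the role of $X_1$, $X_{p_1,2}$ of $X_2$, and so on. *)

(* Defs.v *)
From Stdlib Require Classical_Prop Classical_Pred_Type.
From HB Require Import structures.
From mathcomp Require Import all_boot all_order all_algebra.
From mathcomp Require Import mpoly.

Set Implicit Arguments.
Unset Strict Implicit.
Unset Printing Implicit Defensive.

Import Order.TTheory GRing.Theory.
Local Open Scope ring_scope.

(** * Monomial ideals

    Subsets of a ring (in particular ideals) are [Prop]-valued predicates;
    a monomial 'X_[u] is represented by its exponent vector [u : 'X_{1..t}],
    and [(v <= u)%MM] is divisibility of 'X_[u] by 'X_[v]. *)

Definition ideal_gen (R : comNzRingType) (S : R -> Prop) : R -> Prop :=
  fun x => exists2 s : seq (R * R),
    (forall c, c \in s -> S c.2) & x = \sum_(c <- s) c.1 * c.2.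

Definition monomials (K : fieldType) (t : nat) (S : 'X_{1..t} -> Prop) :
    {mpoly K[t]} -> Prop :=
  fun x => exists2 u, S u & x = 'X_[u].

(* G(I); see [mingens_minimal] below. *)
Definition mingens (K : fieldType) (t : nat) (I : {mpoly K[t]} -> Prop) :
    'X_{1..t} -> Prop :=
  fun u => I 'X_[u] /\ (forall v, I 'X_[v] -> (v <= u)%MM -> v = u).

Definition monomial_ideal_in_degree (K : fieldType) (t : nat) (d : nat)
    (I : {mpoly K[t]} -> Prop) : Prop :=
  exists2 S : 'X_{1..t} -> Prop,
    (forall u, S u -> mdeg u = d) &
    (forall x, I x <-> ideal_gen (monomials S) x).

(* The variable of index 0 is the largest one.  That (X_q u) / X_p is a
   monomial of G(I) is expressed as X_p w = X_q u for some w in G(I). *)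
Definition weakly_polymatroidal (K : fieldType) (t : nat)
    (I : {mpoly K[t]} -> Prop) : Prop :=
  (exists d, monomial_ideal_in_degree d I) /\
  (forall u v, mingens I u -> mingens I v ->
   forall q : 'I_t,
     (forall j : 'I_t, (j < q)%N -> u j = v j) -> (u q < v q)%N ->
   exists2 p : 'I_t, (q < p)%N &
     exists2 w, mingens I w & (U_(p) + w = U_(q) + u)%MM).

(** * Isotone maps and their ideals

    [n] = {1, ..., n} is represented by 'I_n = {0, ..., n-1}, with the same
    order. *)

Definition poset_ideal (T : finType) (le : rel T) (Q I : {set T}) : Prop :=
  [/\ I != set0, I \subset Q &
      forall x y, x \in Q -> y \in I -> le x y -> x \in I].

Definition le_map (P : finType) (n : nat) : rel {ffun P -> 'I_n} :=
  fun f g => [forall x, (f x <= g x)%N].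

Definition homset (d : Order.disp_t) (P : finPOrderType d) (m n : nat)
    (p : 'I_m -> P) (A : 'I_m -> {set 'I_n}) : {set {ffun P -> 'I_n}} :=
  [set f : {ffun P -> 'I_n} |
    [forall x : P, forall y : P, (x <= y)%O ==> (f x <= f y)%N] &&
    [forall i, f (p i) \in A i]].

Lemma varidx_subproof (m n : nat) (k : 'I_m) (i : 'I_n) : (k * n + i < m * n)%N.
Proof.
by apply: leq_trans (leq_mul (ltn_ord k) (leqnn n)); rewrite mulSn addnC ltn_add2r.
Qed.

(* The position of X_{p_k,i} among the m * n variables, listed as
   X_{p_1,1} > ... > X_{p_1,n} > X_{p_2,1} > ... > X_{p_m,n}. *)
Definition varidx (m n : nat) (k : 'I_m) (i : 'I_n) : 'I_(m * n) :=
  Ordinal (varidx_subproof k i).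

(* The product over P is indexed by the numbering p, assumed bijective. *)
Definition Umon (K : fieldType) (P : finType) (m n : nat) (p : 'I_m -> P)
    (f : {ffun P -> 'I_n}) : {mpoly K[m * n]} :=
  \prod_(k < m) 'X_(varidx k (f (p k))).

Definition Lideal (K : fieldType) (P : finType) (m n : nat) (p : 'I_m -> P)
    (B : {set {ffun P -> 'I_n}}) : {mpoly K[m * n]} -> Prop :=
  ideal_gen (fun x => exists2 f, f \in B & x = Umon K p f).

Arguments Lideal K {P m n} p B _.

(** * G(I) is the smallest monomial generating set of a monomial ideal *)

Lemma ideal_gen_mul (R : comNzRingType) (S : R -> Prop) a x :
  ideal_gen S x -> ideal_gen S (a * x).
Proof.
case=> s Ss ->; exists [seq (a * c.1, c.2) | c <- s].
  by move=> c /mapP[c0 c0s ->] /=; apply: Ss.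
by rewrite big_map mulr_sumr; apply: eq_bigr => c _; rewrite mulrA.
Qed.

Lemma ideal_gen_sum (R : comNzRingType) (S : R -> Prop) (T : eqType)
    (r : seq T) (F : T -> R) :
  (forall c, c \in r -> ideal_gen S (F c)) -> ideal_gen S (\sum_(c <- r) F c).
Proof.
elim: r => [|c r IHr] Sr; first by exists [::] => //; rewrite !big_nil.
rewrite big_cons.
have [|s Ss ->] := Sr c; first by rewrite inE eqxx.
have [|s' Ss' ->] := IHr; first by move=> e er; apply: Sr; rewrite inE er orbT.
exists (s ++ s'); last by rewrite big_cat.
by move=> e; rewrite mem_cat => /orP[/Ss|/Ss'].
Qed.

Lemma ideal_gen_sub (R : comNzRingType) (S : R -> Prop) x :
  S x -> ideal_gen S x.
Proof.
move=> Sx; exists [:: (1, x)]; last by rewrite big_seq1 mul1r.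
by move=> c; rewrite inE => /eqP->.
Qed.

Lemma ideal_gen_monomials_dvd (K : fieldType) (t : nat)
    (S : 'X_{1..t} -> Prop) u :
  ideal_gen (monomials S) ('X_[u] : {mpoly K[t]}) ->
  exists2 v, S v & (v <= u)%MM.
Proof.
case=> s Ss /(congr1 (mcoeff u)); rewrite mcoeffX eqxx raddf_sum /= => e.
have [/hasP[c cs cu]|/hasPn h] :=
  boolP (has (fun c : {mpoly K[t]} * {mpoly K[t]} => (c.1 * c.2)@_u != 0) s).
  have [v Sv ec] := Ss _ cs; exists v => //.
  move: cu; rewrite ec -mcoeff_msupp (perm_mem (msuppMX _ _)) => /mapP[w _ ->].
  by rewrite lem_addr.
move/eqP: e; rewrite big_seq big1 ?oner_eq0 // => c /h.
by rewrite negbK => /eqP.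
Qed.

Lemma mingens_minimal (K : fieldType) (t : nat) (I : {mpoly K[t]} -> Prop)
    (S : 'X_{1..t} -> Prop) :
  (forall x, I x <-> ideal_gen (monomials S) x) ->
  (forall u, mingens I u -> S u) /\
  (forall x, I x <-> ideal_gen (monomials (mingens I)) x).
Proof.
move=> IS; split=> [u [/IS Iu minu]|x].
  have [v Sv vu] := ideal_gen_monomials_dvd Iu.
  by rewrite -(minu v) //; apply/IS/ideal_gen_sub; exists v.
split=> [/IS[s Ss ->]|[s Gs ->]]; last first.
  apply/IS/ideal_gen_sum => c /Gs[u [/IS Iu _] ->].
  exact: ideal_gen_mul.
apply: ideal_gen_sum => c /Ss[u Su ->]; apply: ideal_gen_mul.
have {Su} Iu : I 'X_[u] by apply/IS/ideal_gen_sub; exists u.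
have [k] := ubnP (mdeg u); elim: k u Iu => // k IHk u Iu uk.
have [minu|] := Classical_Prop.classic (mingens I u).
  by apply: ideal_gen_sub; exists u.
move=> Gu; have {Gu} := Classical_Prop.not_and_or _ _ Gu.
case=> [/(_ Iu)[]|/Classical_Pred_Type.not_all_ex_not[v]].
move=> nv; have [Iv {}nv] := Classical_Prop.imply_to_and _ _ nv.
have {nv} [vu neq_vu] := Classical_Prop.imply_to_and _ _ nv.
rewrite -(submK vu) mpolyXD; apply/ideal_gen_mul/IHk => //.
have uv0 : (u - v)%MM != 0%MM.
  by apply: contra_notN neq_vu => /eqP e; rewrite -[RHS](submK vu) e add0m.
move: uk; rewrite -{1}(submK vu) mdegD ltnS; apply: leq_trans.
by rewrite -[X in (X < _)%N]add0n ltn_add2r lt0n mdeg_eq0.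
Qed.

(* Main.v *)
Require Import Defs.
From mathcomp Require Import all_boot all_order all_algebra.
From mathcomp Require Import mpoly.

Set Implicit Arguments.
Unset Strict Implicit.
Unset Printing Implicit Defensive.

Import Order.TTheory.

(** The monomials [U_f], for [f] in the ideal [B], all have degree [m], so none
    properly divides another and [G(L(B))] is exactly the set of the [U_f].

    The exponent of [X_{p_k,i}] in [U_f] is 1 if [f (p_k) = i] and 0 otherwise.
    Hence, if [X_q = X_{p_k,i}] is the first variable at which the exponents of
    [U_f] and [U_g] differ, and [U_g] has the larger one there, then [f] and
    [g] agree on [p_1, ..., p_{k-1}] and [g (p_k) = i < f (p_k)].  Let [h] be
    [f] with its value at [p_k] lowered to [i] ([update_isotone]).  It is again
    isotone: an element below [p_k] is some [p_j] with [j < k], where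
    [f (p_j) = g (p_j) <= g (p_k) = i]; above [p_k], [f] only takes values
    [>= f (p_k) > i].  The conditions [h (p_j) \in A_j] are inherited from [f]
    and, at [p_k], from [g].  Since [h <= f], the map [h] lies in [B], and
    [U_h = X_{p_k,i} U_f / X_{p_k,f(p_k)}], where [X_{p_k,f(p_k)}] comes after
    [X_q]. *)

Lemma ideal_gen_ext (R : comNzRingType) (S T : R -> Prop) :
  (forall x, S x <-> T x) -> forall x, ideal_gen S x <-> ideal_gen T x.
Proof.
by move=> ST x; split=> -[s Ss ->]; exists s => // c /Ss /ST.
Qed.

(** No monomial properly divides another one of the same degree, so generating
    monomials of a common degree are all minimal. *)
Lemma mingens_equigenerated (K : fieldType) (t e : nat)
    (I : {mpoly K[t]} -> Prop) (S : 'X_{1..t} -> Prop) :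
  (forall u, S u -> mdeg u = e) ->
  (forall x, I x <-> ideal_gen (monomials S) x) ->
  forall u, mingens I u <-> S u.
Proof.
move=> degS IS u; split=> [|Su]; first exact: (mingens_minimal IS).1.
split=> [|v /IS Iv vu]; first by apply/IS/ideal_gen_sub; exists u.
have [w Sw wv] := ideal_gen_monomials_dvd Iv.
have deg_le a b : (a <= b)%MM -> (mdeg b <= mdeg a)%N -> a = b :> 'X_{1..t}.
  move=> ab; rewrite -{1}(submK ab) mdegD -{2}[mdeg a]add0n leq_add2r leqn0.
  by rewrite mdeg_eq0 => /eqP ba0; rewrite -[RHS](submK ab) ba0 add0m.
have wu : w = u.
  by apply: deg_le (lepm_trans wv vu) _; rewrite (degS _ Sw) (degS _ Su).
by apply: deg_le vu _; rewrite -wu -{1}(submK wv) mdegD leq_addl.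
Qed.

Lemma varidx_inj (m n : nat) (k l : 'I_m) (i j : 'I_n) :
  (varidx k i == varidx l j) = (k == l) && (i == j).
Proof.
apply/eqP/andP=> [/(congr1 val) /= e|[/eqP-> /eqP->] //].
have n0 : (0 < n)%N := leq_ltn_trans (leq0n i) (ltn_ord i).
split; apply/eqP/val_inj.
  by have := congr1 (divn^~ n) e; rewrite !divnMDl // !divn_small // !addn0.
by have := congr1 (modn^~ n) e; rewrite !modnMDl !modn_small.
Qed.

Lemma varidx_surj (m n : nat) (q : 'I_(m * n)) :
  exists k i, q = varidx k i :> 'I_(m * n).
Proof.
have n0 : (0 < n)%N by case: n q => // -[q]; rewrite muln0.
have km : (q %/ n < m)%N by rewrite ltn_divLR.
exists (Ordinal km), (Ordinal (ltn_pmod q n0)).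
by apply/val_inj; rewrite /= -divn_eq.
Qed.

Lemma varidx_ltl (m n : nat) (k l : 'I_m) (i j : 'I_n) :
  (k < l)%N -> (varidx k i < varidx l j)%N.
Proof.
move=> kl /=; apply: leq_trans (leq_addr j (l * n)).
by apply: leq_trans (leq_mul kl (leqnn n)); rewrite mulSn addnC ltn_add2r.
Qed.

Section IsotoneMonomials.

Context (P : finType) (m n : nat) (p : 'I_m -> P).
Implicit Types f g : {ffun P -> 'I_n}.

Definition Uexp f : 'X_{1..m * n} :=
  (\sum_(k < m) U_(varidx k (f (p k))))%MM.

Lemma UmonE (K : fieldType) f : Umon K p f = 'X_[Uexp f].
Proof. by rewrite /Umon /Uexp (big_morph _ (@mpolyXD _ _) (mpolyX0 _ _)). Qed.

Lemma mdeg_Uexp f : mdeg (Uexp f) = m.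
Proof.
rewrite /Uexp mdeg_sum (eq_bigr (fun=> 1%N)) => [|k _]; last exact: mdeg1.
by rewrite sum1_card card_ord.
Qed.

Lemma Uexp_varidx f k i : Uexp f (varidx k i) = (f (p k) == i).
Proof.
rewrite /Uexp mnm_sumE (bigD1 k) //= mnm1E varidx_inj eqxx big1 ?addn0 //.
by move=> l /negPf lk; rewrite mnm1E varidx_inj lk.
Qed.

Lemma Lideal_monomials (K : fieldType) (B : {set {ffun P -> 'I_n}}) x :
  Lideal K p B x <->
  ideal_gen (monomials (fun u => exists2 f, f \in B & u = Uexp f)) x.
Proof.
apply: ideal_gen_ext => y; split=> [[f fB ->]|[u [f fB ->] ->]].
  by exists (Uexp f); [exists f | rewrite UmonE].
by exists f; rewrite ?UmonE.
Qed.

Lemma mingens_Lideal (K : fieldType) (B : {set {ffun P -> 'I_n}}) u :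
  mingens (Lideal K p B) u <-> exists2 f, f \in B & u = Uexp f.
Proof.
apply: (mingens_equigenerated (e := m)) (@Lideal_monomials K B) u => _ [f _ ->].
exact: mdeg_Uexp.
Qed.

(** Since [U_f] contains exactly one variable of each block
    [X_{p_l,1}, ..., X_{p_l,n}], equality of the exponents on a block gives
    equality of the values at [p_l]; within the block of [p_k], the variables
    before [X_{p_k,i}] do not divide [U_g], hence not [U_f] either. *)
Lemma Uexp_first_diff f g k i :
  (forall j : 'I_(m * n), (j < varidx k i)%N -> Uexp f j = Uexp g j) ->
  (Uexp f (varidx k i) < Uexp g (varidx k i))%N ->
  [/\ forall l : 'I_m, (l < k)%N -> f (p l) = g (p l),
      g (p k) = i & (i < f (p k))%N].
Proof.
move=> eqU; rewrite !Uexp_varidx.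
case: eqP => //= fki; case: eqP => //= gki _; split=> // [l lk|].
  have := eqU _ (varidx_ltl (f (p l)) i lk).
  by rewrite !Uexp_varidx eqxx; case: eqP.
rewrite ltnNge; apply/negP; rewrite leq_eqVlt => /orP[/eqP/val_inj //|lt_fi].
(* otherwise X_{p_k,f(p_k)} would be an earlier variable, dividing U_f only *)
have := eqU (varidx k (f (p k))); rewrite !Uexp_varidx eqxx /= ltn_add2l.
by move=> /(_ lt_fi); rewrite gki; case: eqP => // /esym.
Qed.

Definition update f (x : P) (i : 'I_n) : {ffun P -> 'I_n} :=
  [ffun y => if y == x then i else f y].

Lemma Uexp_update f k i : injective p ->
  (U_(varidx k (f (p k))) + Uexp (update f (p k) i)
   = U_(varidx k i) + Uexp f)%MM.
Proof.
move=> p_inj; rewrite /Uexp (bigD1 k) // [in RHS](bigD1 k) //= ffunE eqxx.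
rewrite addmA [X in (X + _)%MM]addmC -addmA; congr (_ + (_ + _))%MM; apply: eq_bigr => l lk.
by rewrite ffunE (inj_eq p_inj) (negPf lk).
Qed.

End IsotoneMonomials.

Lemma update_le_map (P : finType) (n : nat) (f : {ffun P -> 'I_n}) x (i : 'I_n) :
  (i <= f x)%N -> le_map (update f x i) f.
Proof. by move=> ifx; apply/forallP=> y; rewrite ffunE; case: eqP => // ->. Qed.

(** Lowering the value at [x] can only break the inequalities with elements
    below [x], which is what the last hypothesis rules out. *)
Lemma update_isotone (d : Order.disp_t) (P : finPOrderType d) (n : nat)
    (f : {ffun P -> 'I_n}) x (i : 'I_n) :
  {homo f : y z / (y <= z)%O >-> (y <= z)%N} -> (i <= f x)%N ->
  (forall y, (y < x)%O -> (f y <= i)%N) ->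
  {homo update f x i : y z / (y <= z)%O >-> (y <= z)%N}.
Proof.
move=> f_homo ifx f_lt y z yz; rewrite !ffunE.
case: (eqVneq y x) yz => [->|yx]; case: (eqVneq z x) => [->|_] yz //.
- exact: leq_trans ifx (f_homo _ _ yz).
- by apply: f_lt; rewrite lt_neqAle yx.
- exact: f_homo.
Qed.

Lemma homsetP (d : Order.disp_t) (P : finPOrderType d) (m n : nat)
    (p : 'I_m -> P) (A : 'I_m -> {set 'I_n}) (f : {ffun P -> 'I_n}) :
  reflect ({homo f : y z / (y <= z)%O >-> (y <= z)%N} /\
           forall i, f (p i) \in A i)
          (f \in homset p A).
Proof.
rewrite inE; apply: (iffP andP) => -[f_homo fA]; split; try exact/forallP.
  by move=> y z; move/forallP/(_ y)/forallP/(_ z)/implyP: f_homo; apply.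
by apply/forallP=> y; apply/forallP=> z; apply/implyP/f_homo.
Qed.

Unset Implicit Arguments.

Theorem lemma3p2 (K : fieldType) (n : nat) (hn : (0 < n)%N)
    (d : Order.disp_t) (P : finPOrderType d)
    (m : nat) (p : 'I_m -> P) (hp : bijective p)
    (hnum : forall i j : 'I_m, (p i < p j)%O -> (i < j)%N)
    (A : 'I_m -> {set 'I_n}) (hA : forall i, A i != set0)
    (B : {set {ffun P -> 'I_n}})
    (hB : poset_ideal (@le_map P n) (homset p A) B) :
  weakly_polymatroidal (Lideal K p B).
Proof.
split.
  exists m, (fun u => exists2 f, f \in B & u = Uexp p f).
    by move=> _ [f _ ->]; apply: mdeg_Uexp.
  exact: Lideal_monomials.
move=> u v /mingens_Lideal[f fB ->] /mingens_Lideal[g gB ->] q.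
have [k [i ->]] := varidx_surj q => eqU ltU.
have [eq_fg gk ltif] := Uexp_first_diff eqU ltU.
have p_inj := bij_inj hp; have [_ /subsetP sBQ Bdown] := hB.
have /homsetP[f_homo fA] := sBQ _ fB; have /homsetP[g_homo gA] := sBQ _ gB.
have if_le := ltnW ltif.
(* X_{p_k,f(p_k)} is the variable to divide by, f (p k) being the value lowered *)
exists (varidx k (f (p k))); first by rewrite /= ltn_add2l.
exists (Uexp p (update f (p k) i)); last exact: Uexp_update.
apply/mingens_Lideal; exists (update f (p k) i) => //.
apply: Bdown fB (update_le_map if_le).
apply/homsetP; split=> [|l].
  apply: update_isotone => // y; have [p' _ p'K] := hp; rewrite -(p'K y).
  (* below p k, f coincides with g, whose value at p k is i *)
  move=> lt_yk; rewrite eq_fg ?hnum // -gk; exact/g_homo/ltW.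
by rewrite ffunE (inj_eq p_inj); case: eqP => [->|_]; rewrite -?gk.
Qed.
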